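(* Let $K$ be any field and let $T\in K^{m_1}\otimes K^{m_2}\otimes K^{m_3}$ be a nonzero tensor that is tight in the standard basis. For every $\xi\in\Xi$, the limsup in the definition of $G_\xi(T)$ is a limit and \[ G_{\xi}(T) = \max_{p \in W(T)} \min_{i\in \{1,2,3\}} 2^{H(p_i) / \xi_i}. \]
   Context: Write $T=\sum t_{j_1j_2j_3} e_{j_1}\otimes e_{j_2}\otimes e_{j_3}$ in the standard bases; the support $\mathrm{supp}(T)$ is the set of $(j_1,j_2,j_3)$ with $t_{j_1j_2j_3}\neq 0$. $T$ is tight (in the standard basis) if there are injective maps $u_i:[m_i]\to\mathbb{Z}$ with $u_1(j_1)+u_2(j_2)+u_3(j_3)=0$ for all $(j_1,j_2,j_3)\in\mathrm{supp}(T)$. $W(T)$ is the set of triples $(p_1,p_2,p_3)$ of marginal distributions (on $[m_1],[m_2],[m_3]$) of probability distributions on $\mathrm{supp}(T)$. $H$ is Shannon entropy (base 2). $T$ is an $i$-slice if its $i$-th flattening $T_{(i)}\in K^{m_i}\otimes(\bigotimes_{j\ne i}K^{m_j})$ has matrix rank one; a slice decomposition of size $(r_1,r_2,r_3)$ is $T=\sum_{i=1}^3\sum_{j=1}^{r_i}T_{i,j}$ with $T_{i,j}$ an $i$-slice. $\Xi=\{\xi\in\mathbb{R}_{\ge0}^3:\max_i\xi_i=1\}$. $S_\xi(T)=\min\{\sum_i r_i^{1/\xi_i}\}$ over slice decompositions of size $(r_1,r_2,r_3)$, where $\xi_i=0$ forces $r_i=0$ and the term is omitted. $G_\xi(T)=\limsup_n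 S_\xi(T^{\otimes n})^{1/n}$ with $T^{\otimes n}$ the Kronecker power (tensor product of each leg). Convention: $2^{H(p_i)/\xi_i}=+\infty$ when $\xi_i=0$. *)

(* Defs.v *)
From HB Require Import structures.
From mathcomp Require Import all_boot all_order all_algebra.
From mathcomp Require Import all_classical all_reals all_analysis.
Set Implicit Arguments.
Unset Strict Implicit.
Unset Printing Implicit Defensive.
Import Order.TTheory GRing.Theory Num.Theory.
Import numFieldNormedType.Exports.
Local Open Scope classical_set_scope.
Local Open Scope ring_scope.

(* A tensor in K^(A 0) (x) K^(A 1) (x) K^(A 2) is its array of coordinates in
   the standard bases; legs are indexed by finite types so that the Kronecker
   power needs no recoding of indices. *)
Notation multi_index A := {dffun forall i : 'I_3, A i}.
Notation tensor K A := {ffun multi_index A -> K}.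

Definition tensor_supp (K : fieldType) (A : 'I_3 -> finType)
    (T : tensor K A) : {set multi_index A} := [set a | T a != 0]%SET.

Definition tight (K : fieldType) (A : 'I_3 -> finType) (T : tensor K A) :
    Prop :=
  exists u : forall i : 'I_3, A i -> int,
    (forall i, injective (u i)) /\
    (forall a : multi_index A, a \in tensor_supp T -> \sum_i u i (a i) = 0).

(* Leg i of T^{(x)n} is (K^(A i))^{(x)n}, with basis {ffun 'I_n -> A i}. *)
Definition kron_index (A : 'I_3 -> finType) (n : nat) : 'I_3 -> finType :=
  fun i => {ffun 'I_n -> A i} : finType.

Definition kron_pow (K : fieldType) (A : 'I_3 -> finType) (T : tensor K A)
    (n : nat) : tensor K (kron_index A n) :=
  [ffun a : multi_index (kron_index A n) =>
    \prod_(k < n) T [ffun i : 'I_3 => a i k]].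

Definition other_index (A : 'I_3 -> finType) (i : 'I_3) : finType :=
  {dffun forall j : {j : 'I_3 | j != i}, A (val j)}.

Definition omit (A : 'I_3 -> finType) (i : 'I_3) (a : multi_index A) :
    other_index A i :=
  [ffun j : {j : 'I_3 | j != i} => a (val j)].

(* The entry in row x and column y is the coordinate T a at the unique a with
   a i = x and omit i a = y (see flatteningE); the sum has a single term. *)
Definition flattening (K : fieldType) (A : 'I_3 -> finType) (i : 'I_3)
    (T : tensor K A) : 'M[K]_(#|A i|, #|other_index A i|) :=
  \matrix_(x, y)
    \sum_(a : multi_index A | (a i == enum_val x) && (omit i a == enum_val y)) T a.

Lemma flatteningE (K : fieldType) (A : 'I_3 -> finType) (i : 'I_3)
    (T : tensor K A) (a : multi_index A) :
  flattening i T (enum_rank (a i)) (enum_rank (omit i a)) = T a.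
Proof.
rewrite mxE !enum_rankK (big_pred1 a) // => b /=.
apply/andP/eqP => [[/eqP bi /eqP bo]|->//].
apply/ffunP => j; have [->//|ji] := eqVneq j i.
by move/ffunP/(_ (exist _ j ji)): bo; rewrite !ffunE.
Qed.

Definition is_slice (K : fieldType) (A : 'I_3 -> finType) (i : 'I_3)
    (T : tensor K A) : Prop := \rank (flattening i T) = 1%N.

Definition slice_decomposable (K : fieldType) (A : 'I_3 -> finType)
    (T : tensor K A) (r : 'I_3 -> nat) : Prop :=
  exists S : forall i : 'I_3, 'I_(r i) -> tensor K A,
    (forall i j, is_slice i (S i j)) /\
    T = \sum_(i < 3) \sum_(j < r i) S i j.

Definition Xi (R : realType) : set ('I_3 -> R) :=
  [set xi | (forall i, 0 <= xi i) /\ \big[Num.max/0]_(i < 3) xi i = 1].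

Definition slice_costs (R : realType) (xi : 'I_3 -> R) (K : fieldType)
    (A : 'I_3 -> finType) (T : tensor K A) : set R :=
  [set \sum_(i < 3 | xi i != 0) (r i)%:R `^ (xi i)^-1 | r in
    [set r : 'I_3 -> nat | slice_decomposable T r /\
                           forall i, xi i = 0 -> r i = 0%N]].

(* For xi in Xi the infimum is a minimum, see S_xi_min. *)
Definition S_xi (R : realType) (xi : 'I_3 -> R) (K : fieldType)
    (A : 'I_3 -> finType) (T : tensor K A) : R :=
  inf (slice_costs xi T).

Definition maximum_of d (V : porderType d) (B : set V) (x : V) : Prop :=
  B x /\ ubound B x.

Definition minimum_of d (V : porderType d) (B : set V) (x : V) : Prop :=
  B x /\ lbound B x.

Lemma slice_costs_neq0 (R : realType) (xi : 'I_3 -> R) (K : fieldType)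
    (A : 'I_3 -> finType) (T : tensor K A) :
  Xi xi -> slice_costs xi T !=set0.
Proof.
move=> [xi0 ximax].
have [i xi1] : exists i, xi i = 1.
  have [i _ e] := @eq_bigmax _ R _ 0 ord0 predT xi isT (fun i _ => xi0 i).
  by exists i; rewrite -e.
pose P x := [exists a : multi_index A, (a i == x) && (T a != 0)].
pose s := enum P.
pose F x : tensor K A := [ffun a : multi_index A => if a i == x then T a else 0].
have Fslice x : P x -> is_slice i (F x).
  move=> /existsP[a /andP[/eqP ai Ta]]; apply/eqP.
  rewrite eqn_leq lt0n mxrank_eq0; apply/andP; split; last first.
    apply/eqP => F0; have := flatteningE i (F x) a.
    by rewrite F0 mxE ffunE ai eqxx => /esym/eqP; rewrite (negPf Ta).
  pose u : 'cV[K]_(#|A i|) := delta_mx (enum_rank x) ord0.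
  pose v : 'rV[K]_(#|other_index A i|) := row (enum_rank x) (flattening i (F x)).
  have -> : flattening i (F x) = u *m v.
    apply/matrixP => p q; rewrite [RHS]mxE big_ord1 !mxE eqxx andbT.
    have [->|px] := eqVneq p (enum_rank x).
      by rewrite mul1r.
    rewrite mul0r big1 // => b /andP[/eqP bi _]; rewrite ffunE bi.
    by case: eqP => // e; move: px; rewrite -e enum_valK eqxx.
  exact: leq_trans (mxrankM_maxl _ _) (rank_leq_col _).
pose r j := if j == i then size s else 0%N.
exists (\sum_(i < 3 | xi i != 0) (r i)%:R `^ (xi i)^-1); exists r => //; split.
  have rs j : (r j <= size s)%N by rewrite /r; case: ifP.
  exists (fun j k => F (tnth (in_tuple s) (widen_ord (rs j) k))); split.
    move=> j k; have ji : j = i.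
      by apply/eqP; case: eqP k => // /eqP jn [k]; rewrite /r (negPf jn).
    have : tnth (in_tuple s) (widen_ord (rs j) k) \in s by apply: mem_tnth.
    by rewrite mem_enum [in is_slice j]ji => /Fslice.
  rewrite (bigD1 i) //= [X in _ + X]big1 ?addr0; last first.
    move=> j jn; rewrite big1 // => k _; exfalso.
    by case: k => k; rewrite /r (negPf jn).
  have -> : \sum_(k < r i) F (tnth (in_tuple s) (widen_ord (rs i) k)) =
            \sum_(x <- s) F x.
    rewrite [RHS](big_tnth _ _ s) /=.
    have ri : r i = size s by rewrite /r eqxx.
    rewrite (reindex (cast_ord (esym ri))) /=; last first.
      by exists (cast_ord ri) => k _; apply: val_inj.
    by apply: eq_bigr => k _; congr (F (tnth _ _)); apply: val_inj.
  apply/ffunP => a; rewrite sum_ffunE.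
  have [Ta|Ta] := eqVneq (T a) 0.
    by rewrite Ta big1 // => x _; rewrite ffunE Ta if_same.
  rewrite (bigD1_seq (a i)) ?enum_uniq //=; last first.
    by rewrite mem_enum; apply/existsP; exists a; rewrite eqxx.
  rewrite ffunE eqxx big1 ?addr0 // => x xa.
  by rewrite ffunE eq_sym (negPf xa).
move=> j xj; rewrite /r; case: eqP => // ji.
by move: xj; rewrite ji xi1 => /eqP; rewrite oner_eq0.
Qed.

Lemma S_xi_min (R : realType) (xi : 'I_3 -> R) (K : fieldType)
    (A : 'I_3 -> finType) (T : tensor K A) :
  Xi xi -> minimum_of (slice_costs xi T) (S_xi xi T).
Proof.
move=> Xxi; have [xi0 ximax] := Xxi.
have xile1 i : xi i <= 1 by rewrite -ximax; apply: le_bigmax.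
pose cost (r : 'I_3 -> nat) : R :=
  \sum_(i < 3 | xi i != 0) (r i)%:R `^ (xi i)^-1.
pose ok (r : 'I_3 -> nat) :=
  slice_decomposable T r /\ forall i, xi i = 0 -> r i = 0%N.
have [_ [r0 r0ok _]] := slice_costs_neq0 T Xxi.
pose N := (Num.truncn (cost r0)).+1.
have rN r : ok r -> cost r <= cost r0 -> forall i, (r i < N.+1)%N.
  move=> [_ rz] rr0 i; have [xiz|xin] := eqVneq (xi i) 0; first by rewrite rz.
  have [->//|ri] := posnP (r i).
  rewrite ltnS -(ler_nat R); apply: ltW.
  apply: le_lt_trans (Num.Theory.truncnS_gt (cost r0)).
  apply: le_trans rr0; rewrite /cost (bigD1 i) //=.
  rewrite ler_wpDr //; first by apply: sumr_ge0 => j _; apply: powR_ge0.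
  apply: le1r_powR; first by rewrite ler1n.
  by rewrite invf_ge1 // lt_def xin xi0.
have rE (r : 'I_3 -> nat) (h : forall i, (r i < N.+1)%N) :
    exists f : {ffun 'I_3 -> 'I_N.+1}, (fun i => val (f i)) = r.
  exists [ffun i => Ordinal (h i)].
  by apply/funext => i; rewrite ffunE.
have [f0 f0E] := rE r0 (rN _ r0ok (lexx _)).
have f0ok : `[< ok (fun i => val (f0 i)) >] by apply/asboolP; rewrite f0E.
case: (@Order.TotalTheory.arg_minP _ R _ f0 (fun f : {ffun 'I_3 -> 'I_N.+1} => `[< ok (fun i => val (f i)) >])
  (fun f => cost (fun i => val (f i))) f0ok) => f /asboolP fok fmin.
pose v := cost (fun i => val (f i)).
have vin : slice_costs xi T v by exists (fun i => val (f i)).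
have vlb : lbound (slice_costs xi T) v.
  move=> _ [r rok <-]; have [rr0|/ltW] := leP (cost r) (cost r0).
    have [g gE] := rE r (rN _ rok rr0).
    by rewrite -/(cost r) -gE; apply: fmin; apply/asboolP; rewrite gE.
  by apply: le_trans; rewrite -f0E; apply: fmin.
suff -> : S_xi xi T = v by [].
apply/eqP; rewrite eq_le; apply/andP; split.
  by apply: ge_inf => //; exists v.
by apply: lb_le_inf => //; exists v.
Qed.

Definition G_seq (R : realType) (xi : 'I_3 -> R) (K : fieldType)
    (A : 'I_3 -> finType) (T : tensor K A) (n : nat) : \bar R :=
  (S_xi xi (kron_pow T n) `^ n%:R^-1)%:E.

Definition G_xi (R : realType) (xi : 'I_3 -> R) (K : fieldType)
    (A : 'I_3 -> finType) (T : tensor K A) : \bar R :=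
  limn_esup (G_seq xi T).

Definition distr_on (R : realType) (I : finType) (D : {set I}) :
    set {ffun I -> R} :=
  [set P | [/\ forall a, 0 <= P a, forall a, a \notin D -> P a = 0
             & \sum_a P a = 1]].

Definition marginal (R : realType) (A : 'I_3 -> finType)
    (P : {ffun multi_index A -> R}) (i : 'I_3) : A i -> R :=
  fun x => \sum_(a : multi_index A | a i == x) P a.

Definition W (R : realType) (K : fieldType) (A : 'I_3 -> finType)
    (T : tensor K A) : set (forall i : 'I_3, A i -> R) :=
  [set marginal P | P in @distr_on R _ (tensor_supp T)].

(* ln 0 = 0 in the library, so the terms with p x = 0 vanish. *)
Definition entropy (R : realType) (I : finType) (p : I -> R) : R :=
  - \sum_x p x * (ln (p x) / ln 2).

Definition exp2_ratio (R : realType) (h x : R) : \bar R :=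
  if x == 0 then +oo%E else (2 `^ (h / x))%:E.

Definition min_exp_entropy (R : realType) (xi : 'I_3 -> R)
    (A : 'I_3 -> finType) (p : forall i : 'I_3, A i -> R) : \bar R :=
  \big[mine/+oo%E]_(i < 3) exp2_ratio (entropy (p i)) (xi i).

(* Main.v *)
(* Lower bound (Tao-Sawin): if the support is tight, every slice decomposition
   of size (r_1, r_2, r_3) yields a cover of the support by coordinate
   hyperplanes, at most r_i of them in direction i.  Kronecker powers of a tight
   tensor are tight, so this applies to T^n; if P is an optimal distribution, one
   direction of the cover captures P_i^n-mass at least 1/3, and a Chernoff bound
   shows that this takes at least exp (n (H(P_i) - o(1))) hyperplanes.
   Upper bound: the empirical distribution of an element of supp(T)^n is a
   distribution on supp(T), hence in some direction i its marginal has entropy at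
   most xi_i times the optimum; by counting types there are at most
   exp (n (xi_i g + o(1))) hyperplanes for such marginals. *)

Require Import Defs.
From HB Require Import structures.
From mathcomp Require Import all_boot all_order all_algebra.
From mathcomp Require Import all_classical all_reals all_analysis.
From mathcomp Require Import ring lra.
Import Order.TTheory GRing.Theory Num.Theory.
Import numFieldNormedType.Exports.
Local Open Scope classical_set_scope.
Local Open Scope ring_scope.
Set Implicit Arguments.
Unset Strict Implicit.
Unset Printing Implicit Defensive.

(** * Slice decompositions and covers of the support *)

(** Gaussian elimination in the order given by [u]: a nontrivial relation among the vectors [f x],
    [x] in [S], would have a [u]-minimal index in its support, and that index would satisfy [P],
    hence lie outside [S]. So these vectors are independent in dimension [r]. *)
Lemma pivot_complement (K : fieldType) (A : finType) (u : A -> int) (r : nat)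
    (f : A -> 'rV[K]_r) :
  exists S : {set A}, (#|S| <= r)%N /\
    forall x, x \notin S -> exists phi : A -> K,
      [/\ phi x != 0, forall y, u y < u x -> phi y = 0
        & \sum_y phi y *: f y = 0].
Proof.
pose P x := exists phi : A -> K,
  [/\ phi x != 0, forall y, u y < u x -> phi y = 0 & \sum_y phi y *: f y = 0].
exists [set x | ~~ `[< P x >]]%SET; split; last first.
  by move=> x; rewrite inE negbK => /asboolP.
set S : {set A} := [set x | _]%SET.
pose M : 'M[K]_(#|S|, r) := \matrix_(k < #|S|) f (enum_val k).
suff /eqP <- : row_free M by exact: rank_leq_col.
apply: inj_row_free => v vM; apply/eqP/contraT => /rV0Pn [k0 vk0].
case: (@Order.TotalTheory.arg_minP _ _ _ k0 (fun k => v ord0 k != 0)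
  (fun k => u (enum_val k)) vk0) => k vk kmin.
have : enum_val k \in S by apply: enum_valP.
rewrite inE => /negP[]; apply/asboolP.
exists (fun y => \sum_(j | enum_val j == y) v ord0 j); split.
- rewrite (big_pred1 k) // => j /=.
  by apply/eqP/eqP => [/enum_val_inj|->].
- move=> y yk; apply: big1 => j /eqP jy; apply/eqP/contraT => vj.
  by have := kmin j vj; rewrite jy leNgt yk.
- rewrite -[RHS]vM mulmx_sum_row.
  under eq_bigr do rewrite scaler_suml.
  rewrite (exchange_big_dep predT) //=; apply: eq_bigr => j _.
  by rewrite (big_pred1 (enum_val j)) ?rowK // => y /=; rewrite eq_sym.
Qed.

Lemma is_slice_factor (K : fieldType) (A : 'I_3 -> finType) (i : 'I_3)
    (T : tensor K A) : is_slice i T ->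
  exists (f : A i -> K) (g : other_index A i -> K),
    forall a, T a = f (a i) * g (omit i a).
Proof.
move=> T1; have := mulmx_base (flattening i T).
move: (col_base _) (row_base _); rewrite T1 => c d cd.
exists (fun x => c (enum_rank x) ord0), (fun y => d ord0 (enum_rank y)) => a.
by rewrite -(flatteningE i) -cd mxE big_ord1.
Qed.

(** Over a fibre of [omit i] only coordinate [i] varies, so the inner sum is a multiple of
    [\sum_x phi i x * f x]. *)
Lemma contract_slice (K : fieldType) (A : 'I_3 -> finType) (i : 'I_3)
    (f : A i -> K) (g : other_index A i -> K) (phi : forall i : 'I_3, A i -> K) :
  \sum_x phi i x * f x = 0 ->
  \sum_(a : multi_index A) f (a i) * g (omit i a) * \prod_j phi j (a j) = 0.
Proof.
move=> phif; rewrite (partition_big (@omit A i) predT) //=.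
apply: big1 => y _.
have [a0 /eqP a0y|none] := pickP (fun a : multi_index A => omit i a == y); last first.
  by rewrite big_pred0.
(* [upd x] replaces coordinate [i] of [a0] by [x], which parametrizes the fibre over [y] by
   [A i]. *)
pose upd (x : A i) : multi_index A := [ffun j => @eqtype.dfwith _ (fun j => A j) a0 i x j].
have upd_i x : upd x i = x by rewrite ffunE eqtype.dfwith_in.
have upd_j x j : j != i -> upd x j = a0 j.
  by move=> ji; rewrite ffunE eqtype.dfwith_out // eq_sym.
rewrite (reindex_onto upd (fun a => a i)) /=; last first.
  move=> a /eqP ay; apply/ffunP => j; have [->|ji] := eqVneq j i.
    by rewrite upd_i.
  rewrite upd_j //; have := erefl y; rewrite -{1}a0y -ay.
  by move/ffunP/(_ (exist _ j ji)); rewrite !ffunE.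
transitivity (\sum_x (phi i x * f x) * (g y * \prod_(j < 3 | j != i) phi j (a0 j))).
  apply: eq_big => [x|x _].
    rewrite upd_i eqxx andbT; apply/eqP; rewrite -a0y.
    by apply/ffunP => -[j ji]; rewrite !ffunE /= eqtype.dfwith_out // eq_sym.
  have -> : omit i (upd x) = y.
    rewrite -a0y.
    by apply/ffunP => -[j ji]; rewrite !ffunE /= eqtype.dfwith_out // eq_sym.
  rewrite (bigD1 i) //= upd_i.
  rewrite (eq_bigr (fun j => phi j (a0 j))) => [|j ji]; last by rewrite upd_j.
  ring.
by rewrite -mulr_suml phif mul0r.
Qed.

(* Contracting [T] with functionals [phi_i] that annihilate the slices and have
   their [u_i]-minimal nonzero coordinate at [x i] isolates the entry [T x]:
   any other support element has the same [u]-sum, so some [u_i] is smaller. *)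
Lemma slice_decomposable_cover (K : fieldType) (A : 'I_3 -> finType)
    (T : tensor K A) (r : 'I_3 -> nat) : tight T -> slice_decomposable T r ->
  exists S : forall i, {set A i}, (forall i, (#|S i| <= r i)%N) /\
    forall a, a \in tensor_supp T -> exists i, a i \in S i.
Proof.
move=> [u [u_inj u0]] [F [Fslice TE]].
(* All [r i] slices in direction [i] are bundled into one map to row vectors, so that a single
   vector relation kills them together. *)
pose cut i (f : A i -> 'rV[K]_(r i)) :=
  forall j, exists g : other_index A i -> K,
    forall a, F i j a = f (a i) ord0 j * g (omit i a).
have /fin_all_exists[f fP] i : exists f, @cut i f.
  have /fin_all_exists[h hP] j : exists h : A i -> K,
      exists g : other_index A i -> K, forall a, F i j a = h (a i) * g (omit i a).
    by have [h [g hg]] := is_slice_factor (Fslice i j); exists h, g.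
  exists (fun x => \row_j h j x) => j; have [g hg] := hP j.
  by exists g => a; rewrite hg mxE.
have /fin_all_exists[S SP] i := pivot_complement (u i) (f i).
exists S; split=> [i|x xT]; first by have [] := SP i.
apply: contrapT => /forallNP xS.
have /fin_all_exists[phi phiP] i : exists phi : A i -> K,
    [/\ phi (x i) != 0, forall y, u i y < u i (x i) -> phi y = 0
      & \sum_y phi y *: f i y = 0].
  by have [_] := SP i; apply; apply/negP/xS.
have : \sum_a T a * \prod_j phi j (a j) = T x * \prod_j phi j (x j).
  rewrite (bigD1 x) //= [X in _ + X]big1 ?addr0 // => a ax.
  have [aT|] := boolP (a \in tensor_supp T); last first.
    by rewrite inE negbK => /eqP ->; rewrite mul0r.
  have [j uj] : exists j, u j (a j) < u j (x j).
    apply: contrapT => /forallNP noj.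
    have le i : u i (x i) <= u i (a i) by rewrite leNgt; apply/negP/noj.
    have : \sum_i (u i (a i) - u i (x i)) = 0.
      by rewrite sumrB !u0 ?subrr.
    move/eqP; rewrite psumr_eq0 => [/allP eq0|i _]; last by rewrite subr_ge0.
    move/eqP: ax; apply; apply/ffunP => i; apply: (u_inj i); apply/eqP.
    by rewrite -subr_eq0; apply: eq0; rewrite mem_index_enum.
  have [_ phi0 _] := phiP j.
  by rewrite (bigD1 j) //= phi0 // mul0r mulr0.
suff -> : \sum_a T a * \prod_j phi j (a j) = 0.
  move/esym/eqP; rewrite mulf_eq0 => /orP[|/prodf_eq0[i _]].
    by move: xT; rewrite inE => /negPf ->.
  by have [/negPf -> _ _] := phiP i.
rewrite TE; under eq_bigr do rewrite sum_ffunE mulr_suml.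
rewrite exchange_big /=; apply: big1 => i _.
under eq_bigr do rewrite sum_ffunE mulr_suml.
rewrite exchange_big /=; apply: big1 => j _.
have [g hg] := fP i j; under eq_bigr do rewrite hg.
apply: (@contract_slice K A i (fun y => f i y ord0 j)).
have [_ _ /rowP/(_ j)] := phiP i.
by rewrite summxE mxE => fj; rewrite -[RHS]fj; apply: eq_bigr => y _; rewrite mxE.
Qed.

(** Uniqueness of digits: the sum is [d ord0] plus a multiple [B * s], and [|d ord0| < B] forces the
    integer [s] to be 0; then induct on [s]. *)
Lemma base_expansion0 (B : int) (n : nat) (d : 'I_n -> int) :
  (forall k, `|d k| < B) -> \sum_(k < n) B ^+ k * d k = 0 -> forall k, d k = 0.
Proof.
elim: n d => [d _ _ []//|n IH d dB]; rewrite big_ord_recl expr0 mul1r.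
have -> : \sum_(i < n) B ^+ lift ord0 i * d (lift ord0 i) =
          B * \sum_(i < n) B ^+ i * d (lift ord0 i).
  by rewrite mulr_sumr; apply: eq_bigr => i _; rewrite exprS mulrA.
set s := \sum_(i < n) _ => ds.
have B0 : 0 < B by apply: le_lt_trans (dB ord0).
have s0 : s = 0.
  apply: contrapT => /eqP sn; have := dB ord0.
  have -> : d ord0 = - (B * s) by apply/eqP; rewrite -addr_eq0 ds.
  rewrite normrN normrM (gtr0_norm B0) gtr_pMr // => s1.
  by move: s1; rewrite ltNge -gtz0_ge1 normr_gt0 sn.
have d0 : d ord0 = 0 by move: ds; rewrite s0 mulr0 addr0.
by move=> k; case: (unliftP ord0 k) => [j|] -> //; apply: IH s0 j => j.
Qed.

(** Sequences are encoded as integers in base [B] with digits [u i (x k)]; a large base makes this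
    injective, and the sum over the legs vanishes digit by digit. *)
Lemma tight_kron_pow (K : fieldType) (A : 'I_3 -> finType) (T : tensor K A)
    (n : nat) : tight T -> tight (kron_pow T n).
Proof.
move=> [u [u_inj u0]].
(* One plus the sum of all differences on all legs, hence strictly larger than each of them. *)
pose B : int := 1 + \sum_i \sum_x \sum_y `|u i x - u i y|.
have uB i x y : `|u i x - u i y| < B.
  rewrite /B ltr_pwDl // (bigD1 i) //= (bigD1 x) //= (bigD1 y) //= -!addrA lerDl.
  by rewrite !addr_ge0 ?sumr_ge0 // => *; rewrite ?sumr_ge0 // => *; rewrite sumr_ge0.
exists (fun i (x : kron_index A n i) => \sum_(k < n) B ^+ k * u i (x k)); split.
  move=> i x y /eqP; rewrite -subr_eq0 -sumrB => /eqP xy.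
  apply/ffunP => k; apply: (u_inj i); apply/eqP; rewrite -subr_eq0; apply/eqP.
  apply: (@base_expansion0 B n (fun k => u i (x k) - u i (y k))) => [j|].
    exact: uB.
  by rewrite -[RHS]xy; apply: eq_bigr => j _; rewrite mulrBr.
move=> a; rewrite inE ffunE => /prodf_neq0 aT.
rewrite exchange_big big1 //= => k _; rewrite -mulr_sumr.
have := u0 [ffun i => a i k]; rewrite inE aT // => /(_ isT).
by under eq_bigr do rewrite ffunE; move=> ->; rewrite mulr0.
Qed.

(** Each support element is assigned one direction [w a] in which it is covered, and the entries of
    [T] are grouped by this direction and the hyperplane used; each nonzero group is a slice. *)
Lemma cover_slice_decomposable (K : fieldType) (A : 'I_3 -> finType)
    (T : tensor K A) (S : forall i, {set A i}) :
  (forall a, a \in tensor_supp T -> exists i, a i \in S i) ->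
  exists2 r : 'I_3 -> nat, slice_decomposable T r &
    forall i, (r i <= #|S i|)%N.
Proof.
move=> cov.
have /fin_all_exists[w wP] (a : multi_index A) :
    exists i, a \in tensor_supp T -> a i \in S i.
  by have [/cov[i ai]|] := boolP (a \in tensor_supp T); [exists i|exists ord0].
pose F i (x : A i) : tensor K A :=
  [ffun a : multi_index A => if (w a == i) && (a i == x) then T a else 0].
(* A slice has rank exactly one, so zero groups are discarded; hence only an inequality between
   [r i] and [#|S i|]. *)
pose Q i : {set A i} := [set x | F i x != 0]%SET.
have QS i : Q i \subset S i.
  apply/fintype.subsetP => x; rewrite inE => Fx.
  have [a] : exists a, F i x a != 0.
    apply: contrapT => /forallNP F0; move/eqP: Fx; apply.
    by apply/ffunP => a; rewrite [RHS]ffunE; apply/eqP/negPn/negP/F0.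
  rewrite ffunE; case: ifP => [/andP[/eqP wa /eqP <-] Ta|]; last by rewrite eqxx.
  by rewrite -wa wP // inE.
have Fslice i (x : A i) : x \in Q i -> is_slice i (F i x).
  rewrite inE => Fx; apply/eqP; rewrite eqn_leq lt0n mxrank_eq0; apply/andP.
  split; last first.
    apply/contra: Fx => /eqP F0; apply/eqP/ffunP => a.
    by rewrite -(flatteningE i) F0 mxE [RHS]ffunE.
  have -> : flattening i (F i x) =
      (delta_mx (enum_rank x) ord0 : 'cV_ _) *m
      row (enum_rank x) (flattening i (F i x)).
    apply/matrixP => p q; rewrite [RHS]mxE big_ord1 !mxE eqxx andbT.
    have [->|px] := eqVneq p (enum_rank x); first by rewrite mul1r.
    rewrite mul0r big1 // => b /andP[/eqP bi _]; rewrite ffunE bi.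
    rewrite [enum_val p == x](_ : _ = false) ?andbF //.
    by apply: contraNF px => /eqP <-; rewrite enum_valK.
  exact: leq_trans (mxrankM_maxl _ _) (rank_leq_col _).
exists (fun i => #|Q i|); last by move=> i; apply: subset_leq_card.
exists (fun i k => F i (enum_val k)); split.
  by move=> i k; apply: Fslice; apply: enum_valP.
apply/ffunP => a; rewrite sum_ffunE.
transitivity (\sum_i \sum_(x in Q i) F i x a); last first.
  by apply: eq_bigr => i _; rewrite sum_ffunE [LHS]big_enum_val.
have FQ i : \sum_(x in Q i) F i x a = \sum_x F i x a.
  rewrite [RHS](bigID (fun x => x \in Q i)) /= [X in _ + X]big1 ?addr0 // => x.
  by rewrite inE negbK => /eqP ->; rewrite ffunE.
under eq_bigr do rewrite FQ.
rewrite (bigD1 (w a)) //= [X in _ + X]big1 ?addr0 => [|i iw]; last first.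
  by apply: big1 => x _; rewrite ffunE eq_sym (negPf iw).
rewrite (bigD1 (a (w a))) //= big1 ?addr0 => [|x xa].
  by rewrite ffunE !eqxx.
by rewrite ffunE [_ == x]eq_sym (negPf xa) andbF.
Qed.

(** * Counting sequences by entropy *)

(** Entropy with natural logarithms, so that [expR] replaces powers of 2. *)
Definition nat_entropy (R : realType) (I : finType) (p : I -> R) : R :=
  - \sum_x p x * ln (p x).

(** Empirical distribution, or type, of a sequence; it has total mass 1 only for [0 < n]. *)
Definition freq (R : realType) (I : finType) (n : nat) (x : {ffun 'I_n -> I})
    (y : I) : R := (\sum_k (x k == y))%:R / n%:R.

Lemma freq_ge0 (R : realType) (I : finType) n (x : {ffun 'I_n -> I}) (y : I) :
  0 <= freq R x y.
Proof. by rewrite /freq divr_ge0. Qed.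

Lemma sum_freq (R : realType) (I : finType) n (x : {ffun 'I_n -> I})
    (F : I -> R) : (0 < n)%N ->
  n%:R * (\sum_y freq R x y * F y) = \sum_k F (x k).
Proof.
move=> n0; rewrite mulr_sumr.
transitivity (\sum_y \sum_k (x k == y)%:R * F y).
  apply: eq_bigr => y _; rewrite mulrA /freq mulrCA divff ?pnatr_eq0 -?lt0n //.
  by rewrite mulr1 natr_sum mulr_suml.
rewrite exchange_big; apply: eq_bigr => k _.
rewrite (bigD1 (x k)) //= eqxx mul1r big1 ?addr0 // => y xy.
by rewrite eq_sym (negPf xy) mul0r.
Qed.

Lemma sum_freq1 (R : realType) (I : finType) n (x : {ffun 'I_n -> I}) :
  (0 < n)%N -> \sum_y freq R x y = 1.
Proof.
move=> n0; have n0' : n%:R != 0 :> R by rewrite pnatr_eq0 -lt0n.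
apply: (mulfI n0'); rewrite mulr1.
under eq_bigr do rewrite -[freq _ _ _]mulr1.
by rewrite (sum_freq x (fun=> 1)) // sumr_const card_ord.
Qed.

Lemma sum_prod_ffun (R : realType) (I : finType) n (p : I -> R) :
  \sum_(x : {ffun 'I_n -> I}) \prod_k p (x k) = (\sum_y p y) ^+ n.
Proof.
rewrite -(bigA_distr_bigA (fun (_ : 'I_n) y => p y)) /=.
by rewrite prodr_const card_ord.
Qed.

(* The product measure [p^n] gives every sequence of type [p] the same mass
   [expR (- n H(p))], and has total mass 1. *)
Lemma card_type_class (R : realType) (I : finType) n (p : I -> R)
    (S : {set {ffun 'I_n -> I}}) : (0 < n)%N ->
  (forall x, x \in S -> freq R x =1 p) ->
  #|S|%:R <= expR (n%:R * nat_entropy p).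
Proof.
move=> n0 Sp; have [->|[x0 x0S]] := set_0Vmem S.
  by rewrite cards0 expR_ge0.
have p0 y : 0 <= p y by rewrite -(Sp x0) ?freq_ge0.
have p1 : \sum_y p y = 1.
  by rewrite -(eq_bigr _ (fun y _ => Sp _ x0S y)) sum_freq1.
have Sprod x : x \in S -> \prod_k p (x k) = expR (- (n%:R * nat_entropy p)).
  move=> xS; have pE := Sp x xS.
  rewrite /nat_entropy mulrN opprK.
  under [in RHS]eq_bigr do rewrite -[X in X * _]pE.
  rewrite sum_freq // expR_sum; apply: eq_bigr => k _.
  rewrite lnK // posrE -pE /freq divr_gt0 ?ltr0n //.
  by rewrite (bigD1 k) //= eqxx.
have : \sum_(x in S) \prod_k p (x k) <= 1.
  have tot : \sum_(x : {ffun 'I_n -> I}) \prod_k p (x k) = 1.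
    by rewrite sum_prod_ffun p1 expr1n.
  rewrite -[leRHS]tot [leRHS](bigID (fun x => x \in S)) /=.
  by rewrite lerDl sumr_ge0 // => x _; apply: prodr_ge0.
rewrite (eq_bigr _ Sprod) sumr_const -[_ *+ #|S|]mulr_natl expRN.
by rewrite ler_pdivrMr ?expR_gt0 // mul1r.
Qed.

(** Method of types: there are at most [n.+1 ^ #|I|] count vectors, and each type class obeys
    [card_type_class]. *)
Lemma card_low_entropy (R : realType) (I : finType) n (c : R)
    (S : {set {ffun 'I_n -> I}}) : (0 < n)%N ->
  (forall x, x \in S -> nat_entropy (freq R x) <= c) ->
  #|S|%:R <= n.+1%:R ^+ #|I| * expR (n%:R * c).
Proof.
move=> n0 Sc.
pose cnt (x : {ffun 'I_n -> I}) : {ffun I -> 'I_n.+1} :=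
  [ffun y => inord (\sum_k (x k == y))].
have cntE x y : cnt x y = (\sum_k (x k == y))%N :> nat.
  rewrite ffunE inordK // ltnS -[leqRHS]card_ord -sum1_card.
  by apply: leq_sum => k _; case: (_ == _).
rewrite -sum1_card (partition_big cnt predT) //= natr_sum.
have -> : n.+1%:R ^+ #|I| * expR (n%:R * c) =
          \sum_(t : {ffun I -> 'I_n.+1}) expR (n%:R * c).
  by rewrite sumr_const card_ffun card_ord -natrX mulr_natl.
apply: ler_sum => t _; rewrite sum1dep_card.
have [x0 /andP[x0S /eqP x0t]|none] :=
    pickP (fun x => (x \in S) && (cnt x == t)); last first.
  by rewrite eq_card0 ?expR_ge0 // => x; rewrite !inE none.
apply: le_trans (_ : expR (n%:R * nat_entropy (freq R x0)) <= _); last first.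
  by rewrite ler_expR ler_wpM2l ?Sc.
apply: card_type_class => // x; rewrite inE => /andP[_ /eqP xt] y.
by rewrite /freq -!cntE xt x0t.
Qed.

(** With [t] as below and [n * t ^ 2 >= 1], one has [n + 1 <= (1 + n * t) ^ 2 <= expR (n * t) ^ 2];
    this is raised to the power [m + 1], which keeps the denominator of [t] nonzero for [m = 0]. *)
Lemma poly_le_exp (R : realType) (m : nat) (e : R) : 0 < e ->
  exists N, forall n, (N <= n)%N -> n.+1%:R ^+ m <= expR (n%:R * e).
Proof.
move=> e0; pose t := e / (2 * m.+1)%:R.
have t0 : 0 < t by rewrite divr_gt0 // ltr0n.
exists (Num.truncn (t ^- 2)).+1 => n Nn.
have nt : 1 <= n%:R * t ^+ 2.
  rewrite -ler_pdivrMr ?exprn_gt0 // mul1r; apply: ltW.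
  by apply: lt_le_trans (truncnS_gt _) _; rewrite ler_nat.
have -> : n%:R * e = (n%:R * t) * (2 * m.+1)%:R.
  by rewrite -mulrA divfK // pnatr_eq0.
rewrite expRM_natr exprM.
have n1 : n.+1%:R <= expR (n%:R * t) ^+ 2.
  have := expR_ge1Dx (n%:R * t); set E := expR _ => h.
  have n0 : 0 <= n%:R :> R by [].
  have n10 : 1 <= n%:R :> R by rewrite ler1n (leq_trans _ Nn).
  apply: le_trans (_ : (1 + n%:R * t) ^+ 2 <= _).
    rewrite -addn1 natrD; have : 0 <= n%:R * t by rewrite mulr_ge0 // ltW.
    nra.
  by rewrite ler_sqr ?nnegrE ?expR_ge0 // addr_ge0 // mulr_ge0 // ltW.
apply: le_trans (_ : n.+1%:R ^+ m.+1 <= _); first by rewrite ler_weXn2l ?ler1n.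
by rewrite lerXn2r // nnegrE ?exprn_ge0 ?expR_ge0.
Qed.

(** The polynomial number of types is absorbed in [e]; the threshold [N] serves all [c] and [S] at
    once. *)
Lemma card_low_entropy_eventually (R : realType) (I : finType) (e : R) :
  0 < e -> exists N, forall n, (N <= n)%N ->
  forall (c : R) (S : {set {ffun 'I_n -> I}}),
    (forall x, x \in S -> nat_entropy (freq R x) <= c) ->
    #|S|%:R <= expR (n%:R * (c + e)).
Proof.
move=> e0; have [N NP] := poly_le_exp #|I| e0.
exists (maxn 1 N) => n; rewrite geq_max => /andP[n0 Nn] c S Sc.
rewrite mulrDr expRD mulrC; apply: le_trans (card_low_entropy n0 Sc) _.
by rewrite ler_wpM2r ?expR_ge0 ?NP.
Qed.

(** From [expR (- y) >= 1 - y] one gets [expR y <= 1 / (1 - y)]. The range includes all negative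
    [y], so that a variable bounded from above can be inserted. *)
Lemma expR_le_quad (R : realType) (y : R) : y <= 2^-1 ->
  expR y <= 1 + y + 2 * y ^+ 2.
Proof.
move=> y2; have y1 : 0 < 1 - y by lra.
apply: le_trans (_ : (1 - y)^-1 <= _).
  rewrite -[leLHS]invrK -expRN lef_pV2 ?posrE ?expR_gt0 //.
  exact: expR_ge1Dx.
rewrite -[leLHS]mul1r ler_pdivrMr //.
have -> : (1 + y + 2 * y ^+ 2) * (1 - y) = 1 + y ^+ 2 * (1 - 2 * y) by ring.
by rewrite lerDl mulr_ge0 ?sqr_ge0 //; lra.
Qed.

(** The mean is negative, so the second-order bound [1 - s e + 2 s^2 V] on the exponential moment is
    below 1 for small [s > 0]. *)
Lemma chernoff_rate (R : realType) (I : finType) (p Y : I -> R) (c e : R) :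
  (forall x, 0 <= p x) -> \sum_x p x = 1 -> (forall x, Y x <= c) -> 0 < e ->
  \sum_x p x * Y x = - e ->
  exists2 s, 0 < s & \sum_x p x * expR (s * Y x) < 1.
Proof.
move=> p0 p1 Yc e0 EY; pose V := \sum_x p x * Y x ^+ 2.
have V0 : 0 <= V by apply: sumr_ge0 => x _; rewrite mulr_ge0 ?sqr_ge0.
(* For [s = e / D], the summand [2 e |c|] ensures [s |c| <= 1/2], the summand [4 V] ensures
   [2 s V < e], and 1 keeps [D] positive. *)
pose D := 4 * V + 2 * e * `|c| + 1.
have ec0 : 0 <= e * `|c| by rewrite mulr_ge0 // ltW.
have D0 : 0 < D by rewrite /D; lra.
have s0 : 0 < e / D by rewrite divr_gt0.
set s := e / D in s0 *; exists s => //.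
have sD : s * D = e by rewrite /s divfK // gt_eqF.
have sc : s * `|c| <= 2^-1.
  rewrite -(ler_pM2r D0).
  have -> : s * `|c| * D = e * `|c| by rewrite mulrAC sD.
  by rewrite /D; lra.
have sV : 2 * s * V < e.
  rewrite -sD (mulrC 2) -mulrA ltr_pM2l // /D; lra.
apply: le_lt_trans (_ : \sum_x p x * (1 + s * Y x + 2 * (s * Y x) ^+ 2) < 1).
  apply: ler_sum => x _; apply: ler_wpM2l => //; apply: expR_le_quad.
  apply: le_trans sc; rewrite ler_pM2l //.
  by apply: le_trans (Yc x) (ler_norm c).
have -> : \sum_x p x * (1 + s * Y x + 2 * (s * Y x) ^+ 2) =
          1 - s * e + s * (2 * s * V).
  rewrite [RHS](_ : _ = \sum_x p x + s * (\sum_x p x * Y x) + s * (2 * s * V)); last first.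
    by rewrite p1 EY mulrN.
  rewrite /V !mulr_sumr -!big_split /=.
  by apply: eq_bigr => x _; ring.
have : s * (2 * s * V) < s * e by rewrite ltr_pM2l.
lra.
Qed.

(* Markov: [q <= a + q (q / a) ^ s] for [q = p^n x] and any [a, s > 0], so a set
   of [p^n]-mass at least 1/3 but of few elements would force
   [p^n (q / a) ^ s] not to decay, contradicting [chernoff_rate]. *)
Lemma card_of_large_mass (R : realType) (I : finType) (p : I -> R) (e : R) :
  (forall x, 0 <= p x) -> \sum_x p x = 1 -> 0 < e ->
  exists N, forall n, (N <= n)%N -> forall S : {set {ffun 'I_n -> I}},
    3^-1 <= \sum_(x in S) \prod_k p (x k) ->
    expR (n%:R * (nat_entropy p - e)) <= #|S|%:R.
Proof.
(* Half of the tolerance goes into the threshold [a = expR (- n h)]; for [q > 0] the sum of the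
   [Y (x k)] is then [ln (q / a)], and [Y] has mean [- e / 2]. *)
move=> p0 p1 e0; pose h := nat_entropy p - e / 2.
have p_le1 x : p x <= 1 by rewrite -p1 (bigD1 x) //= lerDl sumr_ge0.
pose Y x := ln (p x) + h.
have Yh x : Y x <= h by rewrite /Y gerDr ln_le0.
have EY : \sum_x p x * Y x = - (e / 2).
  under eq_bigr do rewrite mulrDr.
  rewrite big_split -mulr_suml p1 mul1r /h /nat_entropy /=; lra.
have e20 : 0 < e / 2 by lra.
have [s s0 rho1] := chernoff_rate p0 p1 Yh e20 EY.
set rho := \sum_x _ in rho1.
have rho0 : 0 <= rho by apply: sumr_ge0 => x _; rewrite mulr_ge0 ?expR_ge0.
have rho_small : \forall n \near \oo, rho ^+ n < 6^-1.
  have /cvgrPdist_lt/(_ 6^-1) : rho ^+ n @[n --> \oo] --> (0 : R).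
    by apply: cvg_expr; rewrite ger0_norm.
  rewrite invr_gt0 ltr0n => /(_ isT); apply: filterS => n.
  by rewrite sub0r normrN ger0_norm ?exprn_ge0.
have [N1 _ N1P] := rho_small.
(* [n * e > 10] makes [expR (n * e / 2) >= 6], which absorbs the mass 1/6 that remains after
   [rho ^ n < 1/6]. *)
exists (maxn N1 (Num.truncn (10 / e)).+1) => n.
rewrite geq_max => /andP[/N1P/= rn Nn] S Smass.
have ne : 10 < n%:R * e.
  rewrite -ltr_pdivrMr //; apply: lt_le_trans (truncnS_gt _) _.
  by rewrite ler_nat.
have bound x : \prod_k p (x k) <=
    expR (- (n%:R * h)) + \prod_(k < n) (p (x k) * expR (s * Y (x k))).
  (* Zero factors are treated apart because [ln 0 = 0] breaks [p = expR (ln p)]; otherwise the sign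
     of [\sum_k Y (x k)] decides which summand dominates. *)
  have [px|] := boolP [forall k, p (x k) != 0]; last first.
    rewrite negb_forall => /existsP[k]; rewrite negbK => /eqP pk.
    rewrite (bigD1 k) //= pk mul0r addr_ge0 ?expR_ge0 //.
    by apply: prodr_ge0 => *; rewrite mulr_ge0 ?expR_ge0.
  have pE k : p (x k) = expR (ln (p (x k))).
    by rewrite lnK // posrE lt_def p0 (forallP px).
  have [sY|sY] := leP (\sum_k Y (x k)) 0.
    rewrite -[leLHS]addr0 lerD //; last first.
      by apply: prodr_ge0 => *; rewrite mulr_ge0 ?expR_ge0.
    rewrite (eq_bigr _ (fun k _ => pE k)) -expR_sum ler_expR.
    move: sY; rewrite big_split /= sumr_const card_ord -mulr_natl; lra.
  rewrite -[leLHS]add0r lerD ?expR_ge0 // big_split /= ler_peMr ?prodr_ge0 //.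
  rewrite -expR_sum -mulr_sumr -[leLHS]expR0 ler_expR mulr_ge0 // ltW //.
have : 3^-1 <= #|S|%:R * expR (- (n%:R * h)) + rho ^+ n.
  apply: le_trans Smass _.
  apply: le_trans (_ : \sum_(x in S) (expR (- (n%:R * h)) +
      \prod_(k < n) (p (x k) * expR (s * Y (x k)))) <= _).
    by apply: ler_sum.
  rewrite big_split /= sumr_const -[_ *+ #|S|]mulr_natl lerD2l.
  rewrite -sum_prod_ffun [leRHS](bigID (fun x => x \in S)) /= lerDl sumr_ge0 // => x _.
  by apply: prodr_ge0 => *; rewrite mulr_ge0 ?expR_ge0.
move=> Sn; have {Sn rn} : 6^-1 <= #|S|%:R * expR (- (n%:R * h)) by lra.
rewrite expRN ler_pdivlMr ?expR_gt0 // => /(le_trans _); apply.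
have -> : n%:R * h = n%:R * (nat_entropy p - e) + n%:R * e / 2.
  by rewrite /h; lra.
rewrite expRD mulrCA ler_peMr ?expR_ge0 //.
have := expR_ge1Dx (n%:R * e / 2); lra.
Qed.

(** * Existence of an optimal distribution *)

(** Only 0 is delicate: near it [|y * ln y| <= 2 * sqrt |y|], by [- ln z <= 1 / z - 1] at
    [z = sqrt y]. For negative arguments [ln] is 0. *)
Lemma xlnx_continuous (R : realType) : continuous (fun x : R => x * ln x).
Proof.
suff at0 : {for (0 : R), continuous (fun x : R => x * ln x)}.
  move=> x; have [x0|x0|-> //] := ltgtP x 0.
    apply: (@near_cst_continuous _ _ 0); near=> y; rewrite ln0 ?mulr0 //.
    by apply: ltW; near: y; apply: lt_nbhsl.
  by apply: cvgM; [apply: cvg_id|apply: continuous_ln].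
have sml (y : R) : `|y| < 1 -> `|y * ln y| <= 2 * Num.sqrt `|y|.
  move=> y1; have [y0|y0] := leP y 0.
    by rewrite ln0 // mulr0 normr0 mulr_ge0 ?sqrtr_ge0.
  rewrite (gtr0_norm y0) in y1 *; set z := Num.sqrt y.
  have z0 : 0 < z by rewrite sqrtr_gt0.
  have yE : y = z ^+ 2 by rewrite sqr_sqrtr // ltW.
  have z1 : z < 1 by rewrite -(ltr_pXn2r (n := 2)) ?nnegrE ?ltW // -yE expr1n.
  have lnz : - ln z <= z^-1 - 1.
    rewrite -lnV ?posrE //; have := @le_ln1Dx R (z^-1 - 1).
    rewrite (_ : 1 + (z^-1 - 1) = z^-1); last by ring.
    by apply; have := invr_gt0 z; rewrite z0; lra.
  rewrite normrM (gtr0_norm y0) ler0_norm ?ln_le0 ?(ltW y1) //.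
  rewrite {1}yE expr2 -mulrA (mulrC 2) ler_pM2l // yE lnXn // -mulr_natr.
  have : z * - ln z <= z * (z^-1 - 1) by rewrite ler_pM2l.
  rewrite mulrBr divff ?gt_eqF //; lra.
apply/cvgrPdist_lt => /= e e0; rewrite mul0r.
have n1 : \forall y \near (0 : R), `|y| < 1 by apply: nbhs0_lt.
have n2 : \forall y \near (0 : R), `|y| < (e / 2) ^+ 2.
  by apply: nbhs0_lt; rewrite exprn_gt0 // divr_gt0.
apply: filterS2 n1 n2 => y y1 ye; rewrite sub0r normrN.
apply: le_lt_trans (sml y y1) _.
have sqe : Num.sqrt ((e / 2) ^+ 2) = e / 2.
  by rewrite sqrtr_sqr ger0_norm // divr_ge0 // ltW.
by rewrite mulrC -ltr_pdivlMr // -sqe ltr_sqrt // exprn_gt0 // divr_gt0.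
Unshelve. all: by end_near. Qed.

(** The arbitrary operation covers both sums and minima; the default [F0] depends on the point
    because [rate] uses an entropy there. *)
Lemma bigop_continuous (X Y : topologicalType) (op : Y -> Y -> Y) (I : Type)
    (r : seq I) (P : pred I) (F0 : X -> Y) (F : I -> X -> Y) :
  (forall f g : X -> Y, continuous f -> continuous g ->
    continuous (fun x => op (f x) (g x))) ->
  continuous F0 -> (forall i, P i -> continuous (F i)) ->
  continuous (fun x => \big[op/F0 x]_(i <- r | P i) F i x).
Proof.
move=> opC F0C FC; elim: r => [|i r IH].
  by rewrite (_ : (fun x => _) = F0) //; apply/funext => y; rewrite big_nil.
have [Pi|Pi] := boolP (P i); last first.
  rewrite (_ : (fun x => _) = fun x => \big[op/F0 x]_(i <- r | P i) F i x) //.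
  by apply/funext => y; rewrite big_cons (negPf Pi).
rewrite (_ : (fun x => _) =
    fun x => op (F i x) (\big[op/F0 x]_(i <- r | P i) F i x)).
  by apply: opC => //; apply: FC.
by apply/funext => y; rewrite big_cons Pi.
Qed.

Lemma sum_continuous (R : realType) (X : topologicalType) (I : finType)
    (P : pred I) (F : I -> X -> R) :
  (forall i, continuous (F i)) -> continuous (fun x => \sum_(i | P i) F i x).
Proof.
move=> FC; apply: (@bigop_continuous X R +%R I _ P (fun=> 0)) => [f g fC gC x||//].
  exact: cvgD (fC x) (gC x).
by move=> x; apply: cvg_cst.
Qed.

(** A closed subset of a product of segments, compact by Tychonoff; the segment of [a] shrinks to
    the point 0 off [D], which encodes the support condition. *)
Lemma simplex_compact (R : realType) (I : finType) (D : {set I}) :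
  compact [set f : prod_topology (fun _ : I => R) | [/\ forall a, 0 <= f a,
    forall a, a \notin D -> f a = 0 & \sum_a f a = 1]].
Proof.
have sumC (P : pred I) : continuous (fun f : prod_topology (fun _ : I => R) => \sum_(a | P a) f a).
  by apply: sum_continuous => a; exact: (@proj_continuous I (fun=> R) a).
have := @compact_closedI (prod_topology (fun _ : I => R))
  [set f | forall a, `[0, (a \in D)%:R]%classic (f a)]
  ((fun f => \sum_a f a) @^-1` [set 1]).
have -> : [set f : prod_topology (fun _ : I => R) | forall a, `[0, (a \in D)%:R]%classic (f a)] `&`
    ((fun f => \sum_a f a) @^-1` [set 1]) =
  [set f : prod_topology (fun _ : I => R) | [/\ forall a, 0 <= f a,
    forall a, a \notin D -> f a = 0 & \sum_a f a = 1]].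
  apply/seteqP; split => [f [/= fa f1]|f [/= f0 fD f1]].
    split=> // a => [|aD].
      by have := fa a; rewrite in_itv => /andP[].
    by have := fa a; rewrite in_itv (negPf aD) -eq_le => /eqP.
  split=> // a; rewrite in_itv /= f0 /=.
  have [aD|/fD -> //] := boolP (a \in D).
  by rewrite -f1 (bigD1 a) //= lerDl sumr_ge0.
apply.
  pose I01 a : set R := `[0, (a \in D)%:R]%classic.
  exact: (@tychonoff I (fun=> R) I01 (fun a => @segment_compact R 0 _)).
by apply: preimage_closed; [move=> f _; apply: sumC|apply: closed_eq].
Qed.

Arguments marginal {R A} P i x.

Lemma marginal_entropy_continuous (R : realType) (A : 'I_3 -> finType) i :
  continuous (fun f : prod_topology (fun _ : multi_index A => R) =>
    nat_entropy (marginal [ffun a => f a] i)).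
Proof.
set X := prod_topology _.
have mC x : continuous (fun f : X => marginal [ffun a => f a] i x).
  rewrite (_ : (fun f : X => _) = fun f : X => \sum_(a : multi_index A | a i == x) f a).
    apply: (@sum_continuous R X _ _ (fun a f => f a)) => a.
    exact: (@proj_continuous (multi_index A) (fun=> R) a).
  by apply/funext => h; apply: eq_bigr => a _; rewrite ffunE.
have mlnC x : continuous (fun f : X => (fun y : R => y * ln y)
    (marginal [ffun a => f a] i x)).
  move=> f; exact: (@continuous_comp X R R _ _ f (mC x f) (@xlnx_continuous R _)).
move=> f; exact: cvgN (@sum_continuous R X _ predT _ mlnC f).
Qed.

(** Logarithm of [min_exp_entropy]: the infinite terms [xi i = 0] are left out, and for [xi i0 = 1]
    the default is the genuine term of [i0], so it does not alter the minimum. *)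
Definition rate (R : realType) (xi : 'I_3 -> R) (i0 : 'I_3)
    (A : 'I_3 -> finType) (P : {ffun multi_index A -> R}) : R :=
  \big[Num.min/nat_entropy (marginal P i0)]_(i < 3 | xi i != 0)
    (nat_entropy (marginal P i) / xi i).

Lemma rate_attained (R : realType) (xi : 'I_3 -> R) (i0 : 'I_3)
    (A : 'I_3 -> finType) (P : {ffun multi_index A -> R}) : xi i0 = 1 ->
  exists2 i, xi i != 0 & rate xi i0 P = nat_entropy (marginal P i) / xi i.
Proof.
move=> xi1; rewrite /rate.
apply: (@big_ind _ (fun v =>
  exists2 i, xi i != 0 & v = nat_entropy (marginal P i) / xi i)).
- by exists i0; rewrite xi1 ?oner_eq0 ?divr1.
- by move=> x y hx hy; rewrite minEle; case: ifP.
- by move=> i xi0; exists i.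
Qed.

Lemma rate_le (R : realType) (xi : 'I_3 -> R) (i0 i : 'I_3)
    (A : 'I_3 -> finType) (P : {ffun multi_index A -> R}) : xi i != 0 ->
  rate xi i0 P <= nat_entropy (marginal P i) / xi i.
Proof.
move=> xi0.
exact: (bigmin_le_cond _ (fun j => nat_entropy (marginal P j) / xi j) xi0).
Qed.

Lemma rate_continuous (R : realType) (xi : 'I_3 -> R) (i0 : 'I_3)
    (A : 'I_3 -> finType) :
  continuous (fun f : prod_topology (fun _ : multi_index A => R) =>
    rate xi i0 [ffun a => f a]).
Proof.
set X := prod_topology _.
pose H i (f : X) : R := nat_entropy (marginal [ffun a => f a] i).
have HC i : continuous (H i) by exact: marginal_entropy_continuous.
apply: (@bigop_continuous X R Num.min 'I_3 _ (fun i => xi i != 0) (H i0)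
  (fun i f => H i f / xi i)) => [f g fC gC x|//|i _ f].
  exact: continuous_min (fC x) (gC x).
exact: (@cvgM R X (nbhs f) _ _ (fun=> (xi i)^-1) _ _ (HC i f) (cvg_cst _)).
Qed.

Lemma min_exp_entropyE (R : realType) (xi : 'I_3 -> R) (i0 : 'I_3)
    (A : 'I_3 -> finType) (P : {ffun multi_index A -> R}) : xi i0 = 1 ->
  min_exp_entropy xi (marginal P) = (expR (rate xi i0 P))%:E.
Proof.
move=> xi1.
have ratioE i : xi i != 0 -> exp2_ratio (entropy (marginal P i)) (xi i) =
    (expR (nat_entropy (marginal P i) / xi i))%:E.
  move=> xi0; rewrite /exp2_ratio (negPf xi0); congr EFin.
  rewrite /powR pnatr_eq0 /=; congr expR.
  (* The [ln 2] from the base of the power cancels the one in the entropy in bits. *)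
  have ln2 : ln 2 != 0 :> R by rewrite gt_eqF // ln_gt0 // ltr1n.
  have -> : entropy (marginal P i) = nat_entropy (marginal P i) / ln 2.
    by rewrite /entropy mulNr mulr_suml; under eq_bigr do rewrite mulrA.
  by rewrite mulrAC divfK.
apply/eqP; rewrite eq_le; apply/andP; split.
  have [i xi0 ->] := rate_attained P xi1; rewrite -ratioE //.
  exact: (bigmin_le _ i (fun j => exp2_ratio (entropy (marginal P j)) (xi j))).
apply: le_bigmin => [|i _]; first exact: leey.
have [xi0|xi0] := eqVneq (xi i) 0; first by rewrite /exp2_ratio xi0 eqxx leey.
by rewrite ratioE // lee_fin ler_expR rate_le.
Qed.

Lemma rate_max (R : realType) (xi : 'I_3 -> R) (i0 : 'I_3)
    (A : 'I_3 -> finType) (D : {set multi_index A}) : D != finset.set0 ->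
  exists2 P, @distr_on R _ D P &
    forall Q, @distr_on R _ D Q -> rate xi i0 Q <= rate xi i0 P.
Proof.
move=> /set0Pn[d dD].
have := compact_EVT_max _ (@simplex_compact R _ D)
  (continuous_subspaceT (@rate_continuous R xi i0 A)).
case=> [|f /set_mem[f0 fD f1] fmax].
  exists (fun a => (a == d)%:R); split=> [a|a|]; first by case: (_ == _).
    by move=> aD; case: eqP aD => [->|]; rewrite ?dD.
  rewrite (bigD1 d) //= eqxx big1 ?addr0 // => a /negPf ad /=.
  by rewrite ad.
exists [ffun a => f a].
  split=> [a|a aD|]; rewrite ?ffunE; [exact: f0|exact: fD|].
  by under eq_bigr do rewrite ffunE.
move=> Q [Q0 QD Q1]; have := fmax Q; rewrite inE /= => /(_ (And3 Q0 QD Q1)).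
by rewrite (_ : [ffun a => Q a] = Q) //; apply/ffunP => a; rewrite ffunE.
Qed.

(** * Asymptotics of the weighted slice rank *)

Lemma freq_distr (R : realType) (I : finType) n (D : {set I})
    (s : {ffun 'I_n -> I}) : (0 < n)%N -> (forall k, s k \in D) ->
  distr_on D [ffun a => freq R s a].
Proof.
move=> n0 sD; split=> [a|a aD|]; rewrite ?ffunE ?freq_ge0 //.
  rewrite /freq big1 ?mul0r // => k _; apply/eqP; rewrite eqb0.
  by apply: contraNneq aD => <-.
by under eq_bigr do rewrite ffunE; rewrite sum_freq1.
Qed.

Lemma marginal_freq (R : realType) (A : 'I_3 -> finType) n
    (s : {ffun 'I_n -> multi_index A}) i :
  marginal [ffun a => freq R s a] i = freq R [ffun k => s k i].
Proof.
apply/funext => x; rewrite /marginal.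
under eq_bigr do rewrite ffunE.
rewrite /freq -mulr_suml -natr_sum exchange_big; congr (_%:R / _).
apply: eq_bigr => k _; rewrite ffunE.
have [<-|skx] := eqVneq (s k i) x.
  by rewrite (bigD1 (s k)) //= eqxx big1 // => a /andP[_]; rewrite eq_sym => /negPf ->.
rewrite big1 // => a /eqP ax; case: eqP => // ska.
by move: skx; rewrite ska ax eqxx.
Qed.

Definition slice_cost (R : realType) (xi : 'I_3 -> R) (r : 'I_3 -> nat) : R :=
  \sum_(i < 3 | xi i != 0) (r i)%:R `^ (xi i)^-1.

(** Direction [i] uses at most [expR (n xi_i (g + d / 2))] hyperplanes, so its cost is at most
    [expR (n (g + d / 2))]; the other half of [d] pays for the three directions. *)
Lemma S_xi_le (R : realType) (xi : 'I_3 -> R) (i0 : 'I_3) (K : fieldType)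
    (A : 'I_3 -> finType) (T : tensor K A) (g d : R) :
  Xi xi -> xi i0 = 1 ->
  (forall Q, distr_on (tensor_supp T) Q -> rate xi i0 Q <= g) -> 0 < d ->
  exists N, forall n, (N <= n)%N ->
    S_xi xi (kron_pow T n) <= expR (n%:R * (g + d)).
Proof.
move=> Xxi xi1 gmax d0; have [xi_ge0 _] := Xxi.
have xi_gt0 i : xi i != 0 -> 0 < xi i by move=> xi0; rewrite lt_def xi0 xi_ge0.
pose small i n (S : {set {ffun 'I_n -> A i}}) :=
  forall x, x \in S -> nat_entropy (freq R x) <= g * xi i.
have /fin_all_exists[N NP] i : exists N, xi i != 0 -> forall n, (N <= n)%N ->
    forall S, @small i n S -> #|S|%:R <= expR (n%:R * (g * xi i + d / 2 * xi i)).
  have [xi0|xi0] := eqVneq (xi i) 0; first by exists 0%N.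
  have e0 : 0 < d / 2 * xi i by rewrite mulr_gt0 ?xi_gt0 // divr_gt0.
  have [N NP] := card_low_entropy_eventually (A i) e0.
  by exists N => _ n Nn S; apply: NP.
(* [n * d > 4] gives [expR (n * d / 2) >= 3]. *)
exists (maxn (Num.truncn (4 / d)).+1 (\max_i N i)) => n.
rewrite geq_max => /andP[dn /bigmax_leqP Nn].
have n0 : (0 < n)%N by apply: leq_trans dn.
have nd : 4 < n%:R * d.
  rewrite -ltr_pdivrMr //; apply: lt_le_trans (truncnS_gt _) _.
  by rewrite ler_nat.
(* Empty where [xi i = 0], as such directions may carry no slice. *)
pose S i : {set kron_index A n i} :=
  [set x | (xi i != 0) && (nat_entropy (freq R (x : {ffun 'I_n -> A i})) <= g * xi i)]%SET.
have cov a : a \in tensor_supp (kron_pow T n) -> exists i, a i \in S i.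
  rewrite inE ffunE => /prodf_neq0 aT.
  (* A triple of sequences is read as a sequence of triples in the support of [T], whose type is a
     distribution there. *)
  pose s := [ffun k => [ffun i => a i k] : multi_index A].
  have sD k : s k \in tensor_supp T by rewrite inE ffunE aT.
  have := gmax _ (freq_distr R n0 sD).
  have [i xi0 ->] := rate_attained [ffun b => freq R s b] xi1.
  rewrite ler_pdivrMr ?xi_gt0 // marginal_freq => Hg; exists i.
  rewrite inE xi0 /=; apply: le_trans Hg.
  by rewrite (_ : [ffun k => s k i] = a i) //; apply/ffunP => k; rewrite !ffunE.
have [r rT rS] := cover_slice_decomposable cov.
have [_ lb] := S_xi_min (kron_pow T n) Xxi.
apply: (le_trans (lb (slice_cost xi r) _)).
  exists r => //; split=> // i xi0; apply/eqP; rewrite -leqn0.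
  apply: leq_trans (rS i) _; rewrite leqn0 cards_eq0; apply/eqP/setP => x.
  by rewrite !inE xi0 eqxx.
have rE i : xi i != 0 -> (r i)%:R `^ (xi i)^-1 <= expR (n%:R * (g + d / 2)).
  move=> xi0.
  have -> : expR (n%:R * (g + d / 2)) =
      expR (n%:R * (g * xi i + d / 2 * xi i)) `^ (xi i)^-1.
    by rewrite -expRM -mulrDl mulrA mulfK.
  apply: ge0_ler_powR; rewrite ?nnegrE ?expR_ge0 ?invr_ge0 //.
  apply: (@le_trans _ _ #|S i|%:R); first by rewrite ler_nat.
  by apply: NP => //; [apply: Nn|move=> x; rewrite inE => /andP[]].
apply: (@le_trans _ _ (\sum_(i < 3) expR (n%:R * (g + d / 2)))).
  rewrite /slice_cost big_mkcond /=; apply: ler_sum => i _.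
  by case: ifP => [/rE //|_]; apply: expR_ge0.
rewrite sumr_const card_ord -[_ *+ 3]mulr_natl.
have -> : n%:R * (g + d) = n%:R * d / 2 + n%:R * (g + d / 2) by lra.
rewrite expRD ler_wpM2r ?expR_ge0 //.
have := expR_ge1Dx (n%:R * d / 2); lra.
Qed.

(** Union bound: the mass of [S i] under the power of the marginal is the [P^n]-mass of the
    sequences whose leg [i] lies in [S i], and these events cover [D^n], of mass 1. *)
Lemma cover_mass (R : realType) (A : 'I_3 -> finType) (D : {set multi_index A})
    (P : {ffun multi_index A -> R}) n (S : forall i, {set {ffun 'I_n -> A i}}) :
  distr_on D P ->
  (forall s : {ffun 'I_n -> multi_index A}, (forall k, s k \in D) ->
    exists i, [ffun k => s k i] \in S i) ->
  1 <= \sum_i \sum_(x in S i) \prod_k marginal P i (x k).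
Proof.
move=> [P0 PD P1] cov.
have legE i : \sum_(x in S i) \prod_k marginal P i (x k) =
    \sum_(s : {ffun 'I_n -> multi_index A} | [ffun k => s k i] \in S i)
      \prod_k P (s k).
  rewrite [RHS](partition_big
    (fun s : {ffun 'I_n -> multi_index A} => [ffun k => s k i]) (fun x => x \in S i)) //=.
  apply: eq_bigr => x xS.
  rewrite (bigA_distr_big_dep (fun k => [pred a : multi_index A | a i == x k])
    (fun _ a => P a)).
  apply: eq_bigl => s; apply/familyP/andP => [sx|[_ /eqP sx] k].
    have sxE : [ffun k => s k i] = x.
      by apply/ffunP => k; rewrite ffunE; apply/eqP/(sx k).
    by rewrite sxE.
  by rewrite inE -sx ffunE.
under eq_bigr do rewrite legE.
rewrite (exchange_big_dep predT) //=.
have tot : \sum_(s : {ffun 'I_n -> multi_index A}) \prod_k P (s k) = 1.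
  by rewrite sum_prod_ffun P1 expr1n.
rewrite -[leLHS]tot; apply: ler_sum => s _.
have Ps0 : 0 <= \prod_k P (s k) by apply: prodr_ge0.
have [/forallP sD|] := boolP [forall k, s k \in D].
  have [i iS] := cov s sD.
  by rewrite (bigD1 i) //= lerDl sumr_ge0.
rewrite negb_forall => /existsP[k /PD sk].
by rewrite {1}(bigD1 k) //= sk mul0r sumr_ge0.
Qed.

Lemma marginal_sum (R : realType) (A : 'I_3 -> finType)
    (P : {ffun multi_index A -> R}) i : \sum_x marginal P i x = \sum_a P a.
Proof. by rewrite [RHS](partition_big (fun a : multi_index A => a i) predT). Qed.

Lemma sum3_large (R : realType) (F : 'I_3 -> R) :
  1 <= \sum_i F i -> exists i, 3^-1 <= F i.
Proof.
move=> F1; apply: contrapT => /forallNP small; move: F1; apply/negP.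
have lt i : F i < 3^-1 by rewrite ltNge; apply/negP/small.
rewrite -ltNge !big_ord_recl big_ord0 addr0.
have := lt ord0; have := lt (lift ord0 ord0).
have := lt (lift ord0 (lift ord0 ord0)); lra.
Qed.

Lemma S_xi_ge (R : realType) (xi : 'I_3 -> R) (i0 : 'I_3) (K : fieldType)
    (A : 'I_3 -> finType) (T : tensor K A) (P : {ffun multi_index A -> R})
    (d : R) :
  Xi xi -> tight T -> distr_on (tensor_supp T) P -> 0 < d ->
  exists N, forall n, (N <= n)%N ->
    expR (n%:R * (rate xi i0 P - d)) <= S_xi xi (kron_pow T n).
Proof.
move=> Xxi Ttight PT d0; have [xi_ge0 _] := Xxi.
have [P0 PD P1] := PT.
have xi_gt0 i : xi i != 0 -> 0 < xi i by move=> xi0; rewrite lt_def xi0 xi_ge0.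
have m0 i x : 0 <= marginal P i x by apply: sumr_ge0.
have /fin_all_exists[N NP] i : exists N, xi i != 0 -> forall n, (N <= n)%N ->
    forall S : {set {ffun 'I_n -> A i}},
    3^-1 <= \sum_(x in S) \prod_k marginal P i (x k) ->
    expR (n%:R * (nat_entropy (marginal P i) - d * xi i)) <= #|S|%:R.
  have [xi0|xi0] := eqVneq (xi i) 0; first by exists 0%N.
  (* The tolerance [d * xi i] becomes [d] after the power [1 / xi i]. *)
  have e0 : 0 < d * xi i by rewrite mulr_gt0 ?xi_gt0.
  have p1 : \sum_x marginal P i x = 1 by rewrite marginal_sum.
  have [N NP] := card_of_large_mass (m0 i) p1 e0.
  by exists N => _ n Nn S; apply: NP.
exists (\max_i N i)%N => n /bigmax_leqP Nn.
have [[r [rT rxi] <-] _] := S_xi_min (kron_pow T n) Xxi.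
have [S [Sr cov]] := slice_decomposable_cover (tight_kron_pow n Ttight) rT.
have mass : 1 <= \sum_i \sum_(x in (S i : {set {ffun 'I_n -> A i}}))
    \prod_k marginal P i (x k).
  apply: cover_mass PT _ => s sD.
  have := cov (finfun (fun i => [ffun k => s k i]) : multi_index (kron_index A n)).
  rewrite inE ffunE => /(_ _)[|i]; last by rewrite ffunE; exists i.
  apply/prodf_neq0 => k _; have := sD k; rewrite inE; congr (T _ != 0).
  by apply/ffunP => i; rewrite !ffunE.
have [i im] := sum3_large mass.
(* For [xi i = 0] there are no slices, so [S i] would be empty and its mass 0. *)
have xi0 : xi i != 0.
  apply/eqP => xi0; have := Sr i; rewrite rxi // leqn0 cards_eq0 => /eqP S0.
  by move: im; rewrite S0 big_set0 leNgt invr_gt0 ltr0n.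
rewrite (bigD1 i) //= -[leLHS]addr0 lerD ?sumr_ge0 //.
apply: (@le_trans _ _ (expR (n%:R * (nat_entropy (marginal P i) - d * xi i))
    `^ (xi i)^-1)).
  rewrite -expRM ler_expR -mulrA ler_wpM2l // mulrBl mulfK //.
  by rewrite lerD2r rate_le.
apply: ge0_ler_powR; rewrite ?nnegrE ?expR_ge0 ?invr_ge0 //.
apply: le_trans (NP i xi0 n (Nn i isT) _ im) _.
by rewrite ler_nat; apply: Sr.
Qed.

(** The bounds say that [ln S / n] tends to [g]; continuity of [expR] transfers this to the
    roots. *)
Lemma G_seq_cvg (R : realType) (xi : 'I_3 -> R) (K : fieldType)
    (A : 'I_3 -> finType) (T : tensor K A) (g : R) :
  (forall d, 0 < d -> exists N, forall n, (N <= n)%N ->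
    expR (n%:R * (g - d)) <= S_xi xi (kron_pow T n) <= expR (n%:R * (g + d))) ->
  G_seq xi T @ \oo --> (expR g)%:E.
Proof.
move=> bnd; pose v n := ln (S_xi xi (kron_pow T n)) / n%:R.
have vg : v n @[n --> \oo] --> g.
  apply/cvgrPdist_le => /= d d0; have [N NP] := bnd d d0.
  exists (maxn 1 N) => // n; rewrite /= geq_max => /andP[n0 /NP/andP[lo up]].
  have S0 : 0 < S_xi xi (kron_pow T n) by apply: lt_le_trans lo; apply: expR_gt0.
  have n0' : 0 < n%:R :> R by rewrite ltr0n.
  have lo' : g - d <= v n.
    by rewrite ler_pdivlMr // mulrC -ler_expR lnK ?posrE.
  have up' : v n <= g + d.
    by rewrite ler_pdivrMr // mulrC -ler_expR lnK ?posrE.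
  by rewrite ler_norml; lra.
apply: cvg_EFin; first by near=> n.
apply: cvg_trans (_ : expR (v n) @[n --> \oo] --> expR g); last first.
  by apply: continuous_cvg vg; apply: continuous_expR.
(* [powR] is [expR] of a product only for a nonzero base; the lower bound provides positivity. *)
apply: near_eq_cvg; have [N NP] := bnd 1 ltr01.
exists N => // n /= /NP/andP[lo _]; rewrite /G_seq /= /powR gt_eqF.
  by rewrite /v mulrC.
by apply: lt_le_trans lo; apply: expR_gt0.
Unshelve. all: by end_near. Qed.

Theorem theorem1p6 (R : realType) (K : fieldType) (m : 'I_3 -> nat)
    (T : tensor K (fun i : 'I_3 => 'I_(m i) : finType))
    (T_neq0 : T != 0) (T_tight : tight T) (xi : 'I_3 -> R) (xiP : Xi xi) :
  G_seq xi T @ \oo --> G_xi xi T /\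
  maximum_of [set min_exp_entropy xi p | p in W T] (G_xi xi T).
Proof.
have [xi_ge0 xi_max] := xiP.
have [i0 xi1] : exists i, xi i = 1.
  have [i _ e] := @eq_bigmax _ R _ 0 ord0 predT xi isT (fun i _ => xi_ge0 i).
  by exists i; rewrite -e.
have T0 : tensor_supp T != finset.set0.
  apply: contraNneq T_neq0 => T0; apply/eqP/ffunP => a; rewrite [RHS]ffunE.
  by move/setP/(_ a): T0; rewrite !inE => /negbFE/eqP.
(* The same [P] serves both bounds: its own rate gives the lower one, its maximality the upper
   one. *)
have [P PT Pmax] := rate_max xi i0 T0.
have cv : G_seq xi T @ \oo --> (expR (rate xi i0 P))%:E.
  apply: G_seq_cvg => d d0.
  have [N1 N1P] := S_xi_ge i0 xiP T_tight PT d0.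
  have [N2 N2P] := S_xi_le xiP xi1 Pmax d0.
  exists (maxn N1 N2) => n; rewrite geq_max => /andP[n1 n2].
  by rewrite N1P ?N2P.
have GE : G_xi xi T = (expR (rate xi i0 P))%:E by have [] := cvg_limn_einf_sup cv.
rewrite GE; split=> //; split.
  by exists (marginal P); [exists P|exact: min_exp_entropyE].
move=> _ [_ [Q QT <-] <-].
by rewrite (min_exp_entropyE _ xi1) lee_fin ler_expR Pmax.
Qed.
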